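(* Fix $\alpha\in(0,1)$, integers $n,N\ge1$, and an antisymmetric comparison function $\psi:\widehat{\mathcal Y}\times\widehat{\mathcal Y}\times\mathcal Y\to\mathbb R$. Assume that either $|\mathcal X|=\infty$ or $|\mathcal Y|=\infty$, and that $\psi$ takes values in $[-B,B]$. Let $\widehat T$ be a black-box test for algorithm comparison, and assume that $\widehat T$ satisfies the assumption-free validity condition $$\mathbb P_P\big(\widehat T(\mathcal A_0,\mathcal A_1,\mathcal D_N)=1\big)\le\alpha\quad\text{for any algorithms }\mathcal A_0,\mathcal A_1\text{ and distribution }P\text{ such that }\Delta_{P,n}(\mathcal A_0,\mathcal A_1)\le0 .$$ Then for any algorithms $\mathcal A_0,\mathcal A_1$ and any distribution $P$ on $\mathcal X\times\mathcal Y$ with $\Delta_{P,n}(\mathcal A_0,\mathcal A_1)>0$, $$\mathbb P_P\big(\widehat T(\mathcal A_0,\mathcal A_1,\mathcal D_N)=1\big)\le\left[\alpha\left(1+\frac{\Delta_{P,n}(\mathcal A_0,\mathcal A_1)+\frac{B(\alpha^{-1}-1)}{N}}{\Delta_P^{\max}-\frac{B(\alpha^{-1}-1)}{N}}\right)^{N/n}\right]\wedge1,$$ provided that $\Delta_P^{\max}>\frac{B(\alpha^{-1}-1)}{N}$.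
   Context: $\mathcal X,\mathcal Y,\widehat{\mathcal Y}$ are measurable spaces; all functions are assumed measurable as appropriate, and singletons $\{(x,y)\}\subset\mathcal X\times\mathcal Y$ are measurable. $a\wedge b=\min(a,b)$; $[n]=\{1,\dots,n\}$. Algorithm: a map $\mathcal A:\bigcup_{m\ge0}(\mathcal X\times\mathcal Y)^m\times[0,1]\to\{\text{measurable functions }\mathcal X\to\widehat{\mathcal Y}\}$, taking a data set (a finite tuple of any size) and a random seed $\xi\in[0,1]$ and returning a fitted model $\mathcal A(\mathcal D;\xi)$; for each $m$ the map $((x_1,y_1),\dots,(x_m,y_m),\xi,x)\mapsto[\mathcal A(\{(x_i,y_i)\}_{i\in[m]};\xi)](x)$ is measurable. No symmetry in the data points is assumed. Comparison function: $\psi$ is antisymmetric, i.e. $\psi(y',y'',y)=-\psi(y'',y',y)$ for all $y\in\mathcal Y$, $y',y''\in\widehat{\mathcal Y}$. For measurable $f_0,f_1:\mathcal X\to\widehat{\mathcal Y}$, $\Delta_P(f_0,f_1)=\mathbb E_P[\psi(f_0(X),f_1(X),Y)]$ with $(X,Y)\sim P$, and $\Delta_P^{\max}=\sup_{f_0,f_1}\Delta_P(f_0,f_1)$. For algorithms, $\Delta_{P,n}(\mathcal A_0,\mathcal A_1)=\mathbb E_P[\Delta_P(\hat f_{0,n},\hat f_{1,n})]$ where $\hat f_{l,n}=\mathcal A_l(\{(X_i,Y_i)\}_{i\in[n]};\xi)$ for $l=0,1$ (same seed for both), $(X_i,Y_i)$ i.i.d. from $P$ and $\xi\sim\mathrm{Unif}[0,1]$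 independent. Data: $\mathcal D_N=\{(X_i,Y_i)\}_{i\in[N]}$ with $(X_i,Y_i)$ i.i.d. from $P$. $\mathbb P_P$ is over $\mathcal D_N$ and any randomization in $\widehat T$. Black-box test (algorithm comparison): let $\mathfrak D=\bigcup_{m\ge0}(\mathcal X\times\mathcal Y)^m$. A function $\widehat T$ taking two algorithms $\mathcal A_0,\mathcal A_1$ and a data set $\mathcal D\in\mathfrak D$ and returning a (possibly randomized) output $\widehat T(\mathcal A_0,\mathcal A_1,\mathcal D)\in\{0,1\}$ is a black-box test if, for some functions $g^{(1)},g^{(2)},\dots,g$ (not depending on the algorithms) and random seeds $\zeta^{(1)},\zeta^{(2)},\dots,\zeta$ i.i.d. $\mathrm{Unif}[0,1]$ (independent of the data), it is produced as follows. (1) At stage $r=1$, generate a data set in $\mathfrak D$ and a seed in $[0,1]$, $(\mathcal D^{(1)},\xi^{(1)})=g^{(1)}(\mathcal D,\zeta^{(1)})$, and compute $\hat f_l^{(1)}=\mathcal A_l(\mathcal D^{(1)};\xi^{(1)})$ for $l=0,1$. (2) For each stage $r=2,3,\dots$, generate $(\mathcal D^{(r)},\xi^{(r)})=g^{(r)}\big(\mathcal D,(\mathcal D^{(s)})_{1\le s<r},(\hat f_l^{(s)})_{1\le s<r;\,l=0,1},(\zeta^{(s)})_{1\le s\le r},(\xi^{(s)})_{1\le s<r}\big)$ and compute $\hat f_l^{(r)}=\mathcal A_l(\mathcal D^{(r)};\xi^{(r)})$ for $l=0,1$. (3) Repeat until some stopping criterion (evaluated on the information generated so far) is reached; $\hat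 r$ denotes the data-dependent total number of rounds, which is finite. (4) Return $\widehat T(\mathcal A_0,\mathcal A_1,\mathcal D)=g\big(\mathcal D,(\mathcal D^{(r)})_{1\le r\le\hat r},(\hat f_l^{(r)})_{1\le r\le\hat r;\,l=0,1},(\zeta^{(r)})_{1\le r\le\hat r},(\xi^{(r)})_{1\le r\le\hat r},\zeta\big)$, as a measurable function of $(\mathcal D,\zeta^{(1)},\zeta^{(2)},\dots,\zeta)$. *)

(* Defs.v *)
From HB Require Import structures.
From mathcomp Require Import all_boot all_order all_algebra.
From mathcomp Require Import all_classical all_reals all_analysis.

Set Implicit Arguments.
Unset Strict Implicit.
Unset Printing Implicit Defensive.

Import Order.TTheory GRing.Theory Num.Theory.
Import numFieldNormedType.Exports.

Local Open Scope classical_set_scope.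
Local Open Scope ring_scope.

Section iid.
Context {d : measure_display} {T : measurableType d} {R : realType}.

Definition cons_pair (n : nat) (z : T * n.-tuple T) : n.+1.-tuple T :=
  [the n.+1.-tuple T of z.1 :: z.2].

Lemma measurable_cons_pair (n : nat) : measurable_fun [set: _] (@cons_pair n).
Proof. exact: measurable_cons. Qed.

HB.instance Definition _ (n : nat) :=
  isMeasurableFun.Build _ _ _ _ (@cons_pair n) (@measurable_cons_pair n).

(* The n-fold product measure: the law of n i.i.d. draws from P. *)
Fixpoint iid_law (P : probability T R) (n : nat) :
    probability (n.-tuple T) R :=
  match n with
  | 0%N => \d_([tuple] : 0.-tuple T)
  | m.+1 => distribution (P \x iid_law P m)%E (@cons_pair m)
  end.

Lemma iid_lawE (P : probability T R) (n : nat) (B : 'I_n -> set T) :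
  (forall i, measurable (B i)) ->
  iid_law P n [set t | forall i, B i (tnth t i)] = (\prod_(i < n) P (B i))%E.
Proof.
elim: n B => [|n IHn] B mB /=.
  by rewrite big_ord0 diracE mem_set// => -[].
rewrite big_ord_recl -IHn// -product_measure1E//; last first.
  rewrite (_ : mkset _ =
      \bigcap_(i in [set: 'I_n]) ((@tnth n T)^~ i @^-1` B (lift ord0 i))).
    apply: fin_bigcap_measurable => // i _; rewrite -[X in measurable X]setTI.
    exact: measurable_tnth.
  by apply/seteqP; split => t /= h i; [move=> _|]; exact: h.
congr (product_measure1 _ _ _); apply/seteqP; split => -[x t] /=.
  move=> h; split; first by have := h ord0.
  by move=> i; have := h (lift ord0 i); rewrite tnthS.
move=> [h0 h] i; case: (unliftP ord0 i) => [j ->|->//].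
by rewrite tnthS; exact: h.
Qed.

End iid.

(* zeta 0, zeta 1, ... are mutually independent with law Unif[0,1]. *)
Definition iid_uniform (R : realType) (d : measure_display)
    (Omega : measurableType d) (Q : probability Omega R)
    (zeta : nat -> {RV Q >-> R}) : Prop :=
  (forall i (B : set R), measurable B ->
     distribution Q (zeta i) B = uniform_prob (@ltr01 R) B) /\
  (forall (s : seq nat) (B : nat -> set R), uniq s ->
     (forall i, measurable (B i)) ->
     Q [set w | forall i, i \in s -> B i (zeta i w)] =
     (\prod_(i <- s) Q (zeta i @^-1` B i))%E).

Section comparison.
Context {R : realType} {dX dY dZ : measure_display}.
Context {X : measurableType dX} {Y : measurableType dY}
        {Yhat : measurableType dZ}.

(* A data set of arbitrary size is a sequence. Seeds live in [0,1]: the values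
   of fit at seeds outside of [0,1] are irrelevant, and nothing below
   depends on them. *)
Record algorithm := Algorithm {
  fit :> seq (X * Y) -> R -> {mfun X >-> Yhat} ;
  measurable_fit : forall m : nat,
    measurable_fun ([set: m.-tuple (X * Y)] `*` `[0%R : R, 1%R]%classic `*` [set: X])
      (fun z : m.-tuple (X * Y) * R * X => fit z.1.1 z.1.2 z.2) }.

Definition antisymmetric_comparison (psi : Yhat -> Yhat -> Y -> R) : Prop :=
  forall y' y'' y, psi y' y'' y = - psi y'' y' y.

Section gaps.
Variables (psi : Yhat -> Yhat -> Y -> R) (P : probability (X * Y)%type R).

Definition model_gap (f0 f1 : {mfun X >-> Yhat}) : R :=
  \int[P]_z psi (f0 z.1) (f1 z.1) z.2.

(* A real supremum: when psi takes values in [-B, B], all gaps lie in [-B, B],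
   and the set is nonempty. *)
Definition max_gap : R :=
  sup (range (fun f : {mfun X >-> Yhat} * {mfun X >-> Yhat} =>
                model_gap f.1 f.2)).

Definition algorithm_gap (n : nat) (A0 A1 : algorithm) : R :=
  \int[(iid_law P n \x uniform_prob (@ltr01 R))%E]_(z in
      [set: n.-tuple (X * Y)] `*` `[0%R : R, 1%R]%classic)
    model_gap (A0 z.1 z.2) (A1 z.1 z.2).

End gaps.

(* A stage s of a black-box procedure: the data set and the seed it submits to
   both algorithms, the two fitted models it gets back, and zeta^(s). *)
Record round := Round {
  round_data : seq (X * Y) ;
  round_seed : R ;
  round_model0 : {mfun X >-> Yhat} ;
  round_model1 : {mfun X >-> Yhat} ;
  round_zeta : R }.

(* [query r D h u] is the data set and seed submitted at stage r >= 1, given the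
   data D, the list h of the stages s < r, and u = zeta^(r). *)
Fixpoint history
    (query : nat -> seq (X * Y) -> seq round -> R -> seq (X * Y) * R)
    (A0 A1 : algorithm) (D : seq (X * Y)) (z : nat -> R) (r : nat) :
    seq round :=
  match r with
  | 0%N => [::]
  | s.+1 =>
      let h := history query A0 A1 D z s in
      let q := query s.+1 D h (z s.+1) in
      rcons h (Round q.1 q.2 (A0 q.1 q.2) (A1 q.1 q.2) (z s.+1))
  end.

Section black_box.
Context {d : measure_display} {Omega : measurableType d}
        {Q : probability Omega R}.

(* The seeds zeta^(1), zeta^(2), ... are zeta 1, zeta 2, ..., and the seed used
   for the final output is zeta 0; they are random variables on a space Omega
   independent of the data, and T = 1 is encoded as true. The number of rounds
   is the first r >= 1 at which the stopping criterion holds; it exists with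
   probability one over the seeds, whatever the algorithms and the data. No
   measurability is required of the intermediate maps, only of T. *)
Definition black_box_test (zeta : nat -> {RV Q >-> R})
    (T : algorithm -> algorithm -> seq (X * Y) -> Omega -> bool) : Prop :=
  exists (query : nat -> seq (X * Y) -> seq round -> R -> seq (X * Y) * R)
         (stop : seq (X * Y) -> seq round -> bool)
         (output : seq (X * Y) -> seq round -> R -> bool),
  [/\ (forall r D h u, 0 <= (query r D h u).2 <= 1),
      (forall (A0 A1 : algorithm) (D : seq (X * Y)),
         {ae Q, forall w, exists r : nat,
           let H := history query A0 A1 D (fun i => zeta i w) in
           [/\ (0 < r)%N, stop D (H r),
               (forall s, (0 < s < r)%N -> ~~ stop D (H s)) &
               T A0 A1 D w = output D (H r) (zeta 0%N w)]}) &
      (forall (A0 A1 : algorithm) (m : nat),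
         measurable_fun [set: m.-tuple (X * Y) * Omega]
           (fun z : m.-tuple (X * Y) * Omega => T A0 A1 z.1 z.2))].

(* Omega carries the randomization of T, independent of the data. *)
Definition rejection_prob
    (T : algorithm -> algorithm -> seq (X * Y) -> Omega -> bool)
    (P : probability (X * Y)%type R) (N : nat) (A0 A1 : algorithm) : \bar R :=
  (iid_law P N \x Q)%E
    [set z : N.-tuple (X * Y) * Omega | T A0 A1 z.1 z.2 = true].

End black_box.
End comparison.

Arguments algorithm R {dX dY dZ} X Y Yhat.
Arguments rejection_prob {R dX dY dZ X Y Yhat d Omega} Q T P N A0 A1.

(* Main.v *)
Require Import Defs.
From HB Require Import structures.
From mathcomp Require Import all_boot all_order all_algebra.
From mathcomp Require Import all_classical all_reals all_analysis.
From mathcomp Require Import measurable_realfun ring lra.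

(** Suppose that the test rejects [(A0, A1)] under [P] with a probability [p]
    above the claimed bound. The contradiction comes from a pair of algorithms
    and a distribution that the test can hardly tell apart from [A0], [A1] and
    [P], but for which the gap has the wrong sign.

    Take a data point [z] and booby-trap the algorithms: on a data set that
    contains [z] they return fixed models [f1] and [f0] (in this order), where
    the gap of [(f0, f1)] under [P] nearly attains the maximum [M]; on all other
    data sets they are [A0] and [A1]. By antisymmetry a sprung trap yields a gap
    close to [- M]. Let [P' = s P + (1 - s) delta_z]. Three facts combine.

    - The trap springs often under [P']. Restricted to the data sets without
      [z], the law of [n] draws from [P'] is at most [s ^ n] times that of [n]
      draws from [P], so the gap under [P'] is at most
      [s (s ^ n (G + M) - M) + (1 - s) B] up to a small error, with [G] the gap
      of [(A0, A1)] ([triggered_gap_le]). The last term is the price of testing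
      the models on the contaminated distribution.
    - Data from [P] are not too rare under [P']: events of [N] draws satisfy
      [P^N <= s ^- N P'^N].
    - The test does not find the trap. Given the data and the seeds, a run
      queries finitely many data sets, hence meets finitely many points. Along
      a sequence of distinct points [z_k], which exists because one of the two
      data spaces is infinite, it almost surely ends up returning the same answer
      with and without the trap at [z_k] ([test_ae_blind]). The probability of a
      different answer thus tends to 0 along the sequence
      ([product_eventually_small]). The event that a query contains [z_k] may
      fail to be measurable; comparing final answers avoids it.

    Choose [s] with [alpha / s ^ N < p], which is just enough for the rejection
    probability to remain above [alpha] after the trap is set
    ([rejection_prob_transfer]). Since [p] is above the bound, [s ^ n] can be
    taken smaller than [(M - b) / (G + M)] with [b = B (1/alpha - 1) / N]
    ([powR_bound_gt]). As [p <= 1] implies [s ^ N > alpha], Bernoulli's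
    inequality bounds the price [(1 - s) B] by [s b] ([contamination_cost]), and
    the gap of the trapped pair is nonpositive. The validity of the test is
    violated. *)

Set Implicit Arguments.
Unset Strict Implicit.
Unset Printing Implicit Defensive.

Import Order.TTheory GRing.Theory Num.Theory.
Import numFieldNormedType.Exports.

Local Open Scope classical_set_scope.
Local Open Scope ring_scope.

(** * Setwise domination of measures up to a factor *)

Section scaled_domination.
Context {R : realType}.

(** All comparisons between a distribution and its contamination take this
    one-sided form, with the whole space or the complement of a point for [S];
    it passes to integrals, products and i.i.d. laws. *)
Definition scaled_le_on {d} {T : measurableType d} (S : set T) (a : R)
    (mu nu : set T -> \bar R) : Prop :=
  forall A, measurable A -> A `<=` S -> (mu A <= a%:E * nu A)%E.

Lemma ge0_integral_scaled_le {d} {T : measurableType d}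
    (mu nu : {measure set T -> \bar R}) (S : set T) (a : R) (f : T -> \bar R) :
  measurable S -> 0 <= a -> scaled_le_on S a mu nu ->
  measurable_fun S f -> (forall x, S x -> 0 <= f x)%E ->
  (\int[mu]_(x in S) f x <= a%:E * \int[nu]_(x in S) f x)%E.
Proof.
move=> mS a0 munu mf f0.
have -> : (\int[mu]_(x in S) f x = \int[mrestr mu mS]_(x in S) f x)%E.
  by apply: eq_measure_integral => A mA AS; rewrite /= /mrestr setIidl.
rewrite (_ : a = (NngNum a0)%:num)//.
rewrite -ge0_integral_mscale//.
rewrite integral_mkcond [leRHS]integral_mkcond.
apply: ge0_le_measure_integral => //.
- move=> A mA; rewrite /= /mrestr /mscale/=.
  apply: (le_trans (munu _ _ _)); [exact: measurableI|by []|].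
  rewrite lee_wpmul2l ?lee_fin// le_measure ?inE//; exact: measurableI.
- by move=> x; rewrite patchE; case: ifPn => //; rewrite inE; exact: f0.
- exact: (measurable_restrictT _ mS).1.
Qed.

(** Tonelli: the sections of a set inside [S1 `*` S2] are empty outside of [S1]
    and lie in [S2], so the two dominations can be used one after the other. *)
Lemma scaled_le_on_product {d1 d2} {T1 : measurableType d1}
    {T2 : measurableType d2}
    (mu1 nu1 : {measure set T1 -> \bar R})
    (mu2 nu2 : {sigma_finite_measure set T2 -> \bar R})
    (S1 : set T1) (S2 : set T2) (a b : R) :
  measurable S1 -> 0 <= a -> 0 <= b ->
  scaled_le_on S1 a mu1 nu1 -> scaled_le_on S2 b mu2 nu2 ->
  scaled_le_on (S1 `*` S2) (a * b) (mu1 \x mu2)%E (nu1 \x nu2)%E.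
Proof.
move=> mS1 a0 b0 h1 h2 C mC CS.
rewrite /product_measure1/=.
have mx1 := measurable_fun_xsection mu2 mC.
have mx2 := measurable_fun_xsection nu2 mC.
have sec0 (m2 : {sigma_finite_measure set T2 -> \bar R}) x :
    x \notin S1 -> m2 (xsection C x) = 0%E.
  move=> xS1; rewrite (_ : xsection C x = set0) ?measure0//.
  apply/seteqP; split => // y; rewrite /xsection/= inE => /CS[/= ? _].
  by move: xS1; rewrite notin_setE.
have restr (m1 : {measure set T1 -> \bar R})
    (m2 : {sigma_finite_measure set T2 -> \bar R}) :
    (\int[m1]_x (m2 \o xsection C) x = \int[m1]_(x in S1) m2 (xsection C x))%E.
  rewrite [RHS]integral_mkcond; apply: eq_integral => x _.
  by rewrite patchE; case: ifPn => // /(sec0 m2).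
rewrite !restr EFinM -muleA.
apply: (@le_trans _ _ (a%:E * \int[nu1]_(x in S1) mu2 (xsection C x))%E).
  apply: ge0_integral_scaled_le => //; exact: measurable_funTS.
rewrite lee_wpmul2l ?lee_fin// -ge0_integralZl//; last exact: measurable_funTS.
apply: ge0_le_integral => //.
- exact: measurable_funTS.
- by apply: measurable_funeM; exact: measurable_funTS.
move=> x S1x; apply: h2; first exact: measurable_xsection.
by move=> y; rewrite /xsection/= inE => /CS[].
Qed.

Lemma measurable_all_tuple {d} {T : measurableType d} (S : set T) n :
  measurable S -> measurable [set t : n.-tuple T | forall i, S (tnth t i)].
Proof.
move=> mS; rewrite (_ : mkset _ =
    \bigcap_(i in [set: 'I_n]) ((@tnth n T)^~ i @^-1` S)).
  apply: fin_bigcap_measurable => // i _; rewrite -[X in measurable X]setTI.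
  exact: measurable_tnth.
by apply/seteqP; split => t /= h i; [move=> _|]; exact: h.
Qed.

Lemma scaled_le_on_iid {d} {T : measurableType d} (P P' : probability T R)
    (S : set T) (a : R) n :
  measurable S -> 0 <= a -> scaled_le_on S a P P' ->
  scaled_le_on [set t : n.-tuple T | forall i, S (tnth t i)] (a ^+ n)
    (iid_law P n) (iid_law P' n).
Proof.
move=> mS a0 PP'; elim: n => [|n IHn] A mA AS.
  by rewrite expr0 mul1e.
rewrite /= /distribution /pushforward exprS.
apply: (scaled_le_on_product mS a0 (exprn_ge0 n a0) PP' IHn).
  by rewrite -[X in measurable X]setTI; exact: measurable_cons_pair.
case=> x t /= /AS h; split; first by have := h ord0.
by move=> i; have := h (lift ord0 i); rewrite tnthS.
Qed.

End scaled_domination.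

(** * Contamination of a distribution by a point mass *)

Section contamination.
Context {R : realType} {d} {T : measurableType d}.

(** The witness is [s P + (1 - s) delta_z]: the point mass can only add weight,
    and adds none away from [z]. *)
Lemma contamination_exists (P : probability T R) (z : T) (s : R) :
  measurable [set z] -> 0 < s <= 1 ->
  exists P' : probability T R,
    scaled_le_on [set: T] s^-1 P P' /\ scaled_le_on (~` [set z]) s P' P.
Proof.
move=> mz /andP[s0 s1].
have c0 : 0 <= 1 - s by rewrite subr_ge0.
pose m : {measure set T -> \bar R} :=
  measure_add (mscale (NngNum (ltW s0)) P) (mscale (NngNum c0) \d_z).
have mE A : m A = (s%:E * P A + (1 - s)%:E * \d_z A)%E.
  exact: measure_addE.
have m1 : m [set: T] = 1%E.
  by rewrite mE probability_setT diracT !mule1 -EFinD subrKC.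
(* The total mass is 1, so that normalizing only packages m as a probability. *)
pose P' : probability T R := mnormalize m P.
have P'E A : P' A = (s%:E * P A + (1 - s)%:E * \d_z A)%E.
  by rewrite -mE /P' /= /mnormalize m1 onee_eq0 /= invr1 mule1.
exists P'; split => A mA AS.
  have -> : P A = (s^-1%:E * (s%:E * P A))%E.
    by rewrite muleA -EFinM mulVf ?lt0r_neq0// mul1e.
  rewrite P'E.
  by rewrite lee_wpmul2l ?lee_fin ?invr_ge0 ?(ltW s0)// leeDl// mule_ge0.
have zA : z \notin A by apply/negP => /set_mem /AS; exact.
by rewrite P'E diracE (negbTE zA) mule0 adde0.
Qed.

End contamination.

(** * Sets that a.e. point leaves eventually *)

Section vanishing.
Context {R : realType} {d1 d2} {T1 : measurableType d1}
        {T2 : measurableType d2}.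

(** The limit superior of [F] has null sections, hence measure 0, and it is the
    decreasing limit of the tails, which contain the [F k]. The hypothesis is put
    section by section because the exceptional null set of a run of the test
    depends on the data. *)
Lemma product_eventually_small (P : probability T1 R) (Q : probability T2 R)
    (F : nat -> set (T1 * T2)) (e : R) :
  (forall k, measurable (F k)) ->
  (forall x, {ae Q, forall w,
    exists k0, forall k, (k0 <= k)%N -> ~ F k (x, w)}) ->
  0 < e -> exists k, ((P \x Q)%E (F k) < e%:E)%E.
Proof.
move=> mF Fae e0.
have mL : measurable (lim_sup_set F).
  by apply: bigcap_measurable => // k _; exact: bigcup_measurable.
have L0 : (P \x Q)%E (lim_sup_set F) = 0%E.
  rewrite /= /product_measure1/= integral0_eq// => x _ /=.
  apply/eqP; rewrite eq_le measure_ge0 andbT.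
  have [N [mN QN sN]] := Fae x.
  rewrite -QN le_measure ?inE//; first exact: measurable_xsection.
  move=> w; rewrite /xsection/= inE => xw; apply: sN => /= -[k0 h].
  by have [k /= kk Fk] := xw k0 I; exact: (h k kk).
have cv : (P \x Q)%E (\bigcup_(k >= n) F k) @[n --> \oo] --> 0%E.
  rewrite -L0; apply: lim_sup_set_cvg => //.
  apply: le_lt_trans (ltry 1); apply: probability_le1.
  exact: bigcup_measurable.
have [|k _ /(_ k (leqnn k)) /= h] := cv _ (@open_ereal_lt' _ 0%E e%:E _).
  by rewrite lte_fin.
exists k; apply: le_lt_trans h.
rewrite le_measure ?inE//; first exact: bigcup_measurable.
by move=> x Fx; exists k => /=.
Qed.

End vanishing.

(** * Booby-trapped algorithms *)

Section trigger.
Context {R : realType} {dX dY dZ : measure_display}.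
Context {X : measurableType dX} {Y : measurableType dY}
        {Yhat : measurableType dZ}.

Lemma forall_tnthP n (t : n.-tuple (X * Y)) (z : X * Y) :
  (forall i, (~` [set z]) (tnth t i)) <-> z \notin (t : seq (X * Y)).
Proof.
split=> [h|zt i /= ti]; last by move: zt; rewrite -ti mem_tnth.
by apply/negP => /tnthP[i zi]; exact: (h i).
Qed.

Lemma measurable_mem_tuple n (z : X * Y) : measurable [set z] ->
  measurable_fun [set: n.-tuple (X * Y)] (fun t => z \in (t : seq (X * Y))).
Proof.
move=> mz; apply: (measurable_fun_bool false) => //; rewrite setTI.
rewrite (_ : _ @^-1` _ = [set t | forall i, (~` [set z]) (tnth t i)]).
  by apply: measurable_all_tuple; exact: measurableC.
by apply/seteqP; split => t /=; rewrite forall_tnthP; [move=> ->|move/negbTE].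
Qed.

Definition triggered_fit (A : algorithm R X Y Yhat) (z : X * Y)
    (f : {mfun X >-> Yhat}) (D : seq (X * Y)) (xi : R) : {mfun X >-> Yhat} :=
  if z \in D then f else A D xi.

Lemma measurable_triggered_fit (A : algorithm R X Y Yhat) (z : X * Y)
    (f : {mfun X >-> Yhat}) m : measurable [set z] ->
  measurable_fun
    ([set: m.-tuple (X * Y)] `*` `[0%R : R, 1%R]%classic `*` [set: X])
    (fun w : m.-tuple (X * Y) * R * X => triggered_fit A z f w.1.1 w.1.2 w.2).
Proof.
move=> mz; rewrite (_ : (fun _ => _) = (fun w : m.-tuple (X * Y) * R * X =>
    if z \in (w.1.1 : seq _) then f w.2 else A w.1.1 w.1.2 w.2)); last first.
  by apply/funext => w; rewrite /triggered_fit; case: ifP.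
apply: measurable_fun_if.
- by apply: measurableX => //; exact: measurableX.
- apply: measurable_funTS.
  apply: (measurableT_comp
            (f := fun t : m.-tuple (X * Y) => z \in (t : seq (X * Y)))
            (g := fun w : m.-tuple (X * Y) * R * X => w.1.1)).
    exact: measurable_mem_tuple.
  exact: measurableT_comp.
- by apply: measurable_funTS; exact: measurableT_comp.
- apply: measurable_funS (measurable_fit A (m := m)) => //.
  by apply: measurableX => //; exact: measurableX.
Qed.

(** The seed does not enter the trigger, so that only a query whose data set
    contains [z] can reveal the trap. *)
Definition triggered (A : algorithm R X Y Yhat) (z : X * Y)
    (mz : measurable [set z]) (f : {mfun X >-> Yhat}) : algorithm R X Y Yhat :=
  Algorithm (fun m => measurable_triggered_fit A f (m := m) mz).

(** The next query depends on the algorithms through their earlier answers only: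
    as long as the queries to the original pair avoid [z], both pairs receive the
    same queries and give the same answers. *)
Lemma triggered_history query (A0 A1 : algorithm R X Y Yhat) (z : X * Y)
    (mz : measurable [set z]) (f0 f1 : {mfun X >-> Yhat}) D zeta r :
  all (fun q : round => z \notin round_data q) (history query A0 A1 D zeta r) ->
  forall s, (s <= r)%N ->
    history query (triggered A0 mz f0) (triggered A1 mz f1) D zeta s =
    history query A0 A1 D zeta s.
Proof.
elim: r => [|r IHr] /=; first by move=> _ s; rewrite leqn0 => /eqP ->.
rewrite all_rcons => /andP[zq /IHr{}IHr] s.
rewrite leq_eqVlt => /predU1P[->|]; last exact: IHr.
rewrite /= IHr//; congr (rcons _ (Round _ _ _ _ _)).
- by rewrite /triggered_fit (negbTE zq).
- by rewrite /triggered_fit (negbTE zq).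
Qed.

End trigger.

(** * Integrals of bounded functions *)

Section bounded_real_integrals.
Context {R : realType} {d} {T : measurableType d}.

Lemma bounded_integrable (mu : probability T R) (S : set T) (f : T -> R)
    (b : R) :
  measurable S -> measurable_fun S f -> (forall x, S x -> `|f x| <= b) ->
  mu.-integrable S (EFin \o f).
Proof.
move=> mS mf fb; apply: measurable_bounded_integrable => //.
  by apply: le_lt_trans (ltry 1); exact: probability_le1.
exists b; split; first exact: num_real.
by move=> c bc x Sx; exact: le_trans (fb x Sx) (ltW bc).
Qed.

Lemma ge0_Rintegral_scaled_le (mu nu : probability T R) (S : set T) (a b : R)
    (f : T -> R) :
  measurable S -> 0 <= a -> scaled_le_on S a mu nu ->
  measurable_fun S f -> (forall x, S x -> 0 <= f x <= b) ->
  \int[mu]_(x in S) f x <= a * \int[nu]_(x in S) f x.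
Proof.
move=> mS a0 munu mf fb.
have int (m : probability T R) : m.-integrable S (EFin \o f).
  apply: (@bounded_integrable _ _ _ b) => // x /fb/andP[? ?].
  by rewrite ger0_norm.
have fin (m : probability T R) := integrable_fin_num mS (int m).
rewrite /Rintegral -lee_fin EFinM !fineK//.
apply: ge0_integral_scaled_le => //; first exact/measurable_EFinP.
by move=> x /fb /andP[? _]; rewrite lee_fin.
Qed.

Lemma Rintegral_support (mu : probability T R) (D S : set T) (f : T -> R) :
  (forall x, D x -> ~ S x -> f x = 0) ->
  \int[mu]_(x in D) f x = \int[mu]_(x in D `&` S) f x.
Proof.
move=> f0; rewrite Rintegral_mkcondr; apply: eq_Rintegral => x /set_mem Dx.
by rewrite patchE; case: ifPn => //; rewrite notin_setE => /(f0 x Dx).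
Qed.

End bounded_real_integrals.

Section pairing.
Context {d d1 d2} {T : measurableType d} {T1 : measurableType d1}
        {T2 : measurableType d2}.

Lemma measurable_fun_pair_on (S : set T) (f : T -> T1) (g : T -> T2) :
  measurable S -> measurable_fun S f -> measurable_fun S g ->
  measurable_fun S (fun x => (f x, g x)).
Proof.
move=> mS mf mg; apply/(measurable_restrictT _ mS).
rewrite (_ : _ \_ S = fun x => ((f \_ S) x, (g \_ S) x)).
  by apply: measurable_fun_pair; apply/(measurable_restrictT _ mS).
by apply/funext => x; rewrite !patchE; case: ifP.
Qed.

End pairing.

(** * Gaps between models *)

Section gap_calculus.
Context {R : realType} {dX dY dZ : measure_display}.
Context {X : measurableType dX} {Y : measurableType dY}
        {Yhat : measurableType dZ}.
Variables (psi : Yhat -> Yhat -> Y -> R) (B : R).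
Hypothesis hpsi_meas : measurable_fun [set: Yhat * Yhat * Y]
  (fun z : Yhat * Yhat * Y => psi z.1.1 z.1.2 z.2).
Hypothesis hB : forall y' y'' y, - B <= psi y' y'' y <= B.

Implicit Types (P : probability (X * Y)%type R) (f : {mfun X >-> Yhat}).

Lemma bound_ge0 : 0 <= B.
Proof.
have /andP[h1 h2] := hB point point point.
by have := le_trans h1 h2; rewrite lerNl -subr_ge0 opprK -mulr2n pmulrn_lge0.
Qed.

Lemma measurable_comparison f0 f1 :
  measurable_fun [set: X * Y] (fun z => psi (f0 z.1) (f1 z.1) z.2).
Proof.
apply: (measurableT_comp hpsi_meas
  (g := fun z : X * Y => (f0 z.1, f1 z.1, z.2))).
apply: measurable_fun_pair => //=.
by apply: measurable_fun_pair => /=; exact: measurableT_comp.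
Qed.

Lemma integrable_comparison P f0 f1 :
  P.-integrable [set: X * Y] (EFin \o (fun z => psi (f0 z.1) (f1 z.1) z.2)).
Proof.
apply: (@bounded_integrable _ _ _ _ _ _ B) => //.
  exact: measurable_comparison.
by move=> z _; rewrite ler_norml.
Qed.

Lemma model_gap_bounded P f0 f1 : `|model_gap psi P f0 f1| <= B.
Proof.
have int := integrable_comparison P f0 f1.
rewrite /model_gap (le_trans (le_normr_Rintegral _ int))//.
have -> : B = \int[P]_(z in [set: X * Y]) B.
  by rewrite Rintegral_cst//= probability_setT mulr1.
apply: le_Rintegral => //.
- exact/integrable_norm.
- apply: (@bounded_integrable _ _ _ _ _ _ B) => // x _.
  by rewrite ger0_norm// bound_ge0.
- by move=> z _; rewrite ler_norml.
Qed.

Lemma model_gap_antisymmetric P f0 f1 : antisymmetric_comparison psi ->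
  model_gap psi P f1 f0 = - model_gap psi P f0 f1.
Proof.
move=> anti; rewrite /model_gap -mulN1r -RintegralZl//; last first.
  exact: integrable_comparison.
by apply: eq_Rintegral => z _; rewrite mulN1r; exact: anti.
Qed.

Lemma has_sup_model_gap P : has_sup
  (range (fun f : {mfun X >-> Yhat} * {mfun X >-> Yhat} =>
            model_gap psi P f.1 f.2)).
Proof.
pose f0 : {mfun X >-> Yhat} := cst point.
split; first by exists (model_gap psi P f0 f0); exists (f0, f0).
exists B => _ [f _ <-]; exact: le_trans (ler_norm _) (model_gap_bounded _ _ _).
Qed.

Lemma model_gap_le_max P f0 f1 : model_gap psi P f0 f1 <= max_gap psi P.
Proof.
by apply: ub_le_sup; [exact: (has_sup_model_gap P).2|exists (f0, f1)].
Qed.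

(** The function [B - psi] is nonnegative, so its integral inherits the
    domination of [P] by [P']. The term [(1 - s) * B] accounts for the part of
    [P'] on which nothing is known of the models. *)
Lemma model_gap_scaled_le P P' f0 f1 (s : R) : 0 < s ->
  scaled_le_on [set: X * Y] s^-1 P P' ->
  model_gap psi P' f0 f1 <= s * model_gap psi P f0 f1 + (1 - s) * B.
Proof.
move=> s0 PP'.
have mB : measurable_fun [set: X * Y] (fun z => B - psi (f0 z.1) (f1 z.1) z.2).
  by apply: measurable_funB => //; exact: measurable_comparison.
have intB (m : probability (X * Y)%type R) :
    \int[m]_z (B - psi (f0 z.1) (f1 z.1) z.2) = B - model_gap psi m f0 f1.
  rewrite RintegralB//; last exact: integrable_comparison.
    by rewrite Rintegral_cst//= probability_setT mulr1.
  apply: (@bounded_integrable _ _ _ _ _ _ B) => // x _.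
  by rewrite ger0_norm// bound_ge0.
have : B - model_gap psi P f0 f1 <= s^-1 * (B - model_gap psi P' f0 f1).
  rewrite -!intB; apply: (@ge0_Rintegral_scaled_le _ _ _ _ _ _ _ (B + B)) => //.
    by rewrite invr_ge0 ltW.
  move=> z _; have /andP[h1 h2] := hB (f0 z.1) (f1 z.1) z.2.
  by rewrite subr_ge0 h2/= lerD2l lerNl.
rewrite ler_pdivlMl// => h.
rewrite mulrBl mul1r -lerBlDr opprB.
by move: h; rewrite mulrBr; lra.
Qed.

Lemma model_gap_add_max_ge0 P f0 f1 : antisymmetric_comparison psi ->
  0 <= model_gap psi P f0 f1 + max_gap psi P.
Proof.
move=> anti; rewrite -lerBlDl sub0r -model_gap_antisymmetric//.
exact: model_gap_le_max.
Qed.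

(** A parametric integral: Tonelli's theorem applies once [psi] is shifted by
    [B] to be nonnegative, and extended by 0 to seeds outside of [0, 1]. *)
Lemma measurable_model_gap P (A0 A1 : algorithm R X Y Yhat) n :
  measurable_fun ([set: n.-tuple (X * Y)] `*` `[0%R : R, 1%R]%classic)
    (fun w : n.-tuple (X * Y) * R => model_gap psi P (A0 w.1 w.2) (A1 w.1 w.2)).
Proof.
set E := _ `*` _.
have mE : measurable E by exact: measurableX.
pose F (u : n.-tuple (X * Y) * R * (X * Y)) :=
  (B + psi (A0 u.1.1 u.1.2 u.2.1) (A1 u.1.1 u.1.2 u.2.1) u.2.2)%:E.
have mA (A : algorithm R X Y Yhat) :
    measurable_fun (E `*` [set: X * Y])
      (fun u : n.-tuple (X * Y) * R * (X * Y) => A u.1.1 u.1.2 u.2.1).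
  apply: (measurable_comp _ _ (measurable_fit A (m := n))
    (g := fun u : n.-tuple (X * Y) * R * (X * Y) => (u.1, u.2.1))).
  - by apply: measurableX => //; exact: measurableX.
  - by move=> _ [u [? _] <-].
  - apply: measurable_funTS; apply: measurable_fun_pair => //=.
    exact: measurableT_comp.
have mEX : measurable (E `*` [set: X * Y]) by exact: measurableX.
have mF : measurable_fun (E `*` [set: X * Y]) F.
  apply/measurable_EFinP; apply: measurable_funD => //.
  apply: (measurableT_comp hpsi_meas
    (g := fun u : n.-tuple (X * Y) * R * (X * Y) =>
      (A0 u.1.1 u.1.2 u.2.1, A1 u.1.1 u.1.2 u.2.1, u.2.2))).
  apply: measurable_fun_pair_on => //.
    by apply: measurable_fun_pair_on => //; exact: mA.
  by apply: measurable_funTS; exact: measurableT_comp.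
have mF' := (measurable_restrictT F mEX).1 mF.
have F0 u : (0 <= (F \_ (E `*` [set: X * Y])) u)%E.
  rewrite patchE; case: ifPn => // _; rewrite lee_fin -lerBlDl sub0r.
  by have /andP[] := hB (A0 u.1.1 u.1.2 u.2.1) (A1 u.1.1 u.1.2 u.2.1) u.2.2.
have mG : measurable_fun E (fubini_F P (F \_ (E `*` [set: X * Y]))).
  by apply: measurable_funTS; exact: measurable_fun_fubini_tonelli_F.
apply/measurable_EFinP.
apply: (eq_measurable_fun
  (fun w => (fubini_F P (F \_ (E `*` [set: X * Y])) w - B%:E)%E)).
  move=> w /set_mem Ew /=; rewrite /fubini_F.
  rewrite (eq_integral (fun z =>
    B%:E + (psi (A0 w.1 w.2 z.1) (A1 w.1 w.2 z.1) z.2)%:E)%E); last first.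
    by move=> z _; rewrite patchE mem_set.
  rewrite integralD//=;
    [|exact: finite_measure_integrable_cst|exact: integrable_comparison].
  rewrite integral_cst// [X in (_ * X + _ + _)%E](probability_setT P) mule1.
  rewrite addeAC subee// add0e.
  rewrite /model_gap /Rintegral fineK//.
  by apply: integrable_fin_num => //; exact: integrable_comparison.
by apply: emeasurable_funB.
Qed.

End gap_calculus.

(** * The trap reverses the sign of the gap *)

Section triggered_gap.
Context {R : realType} {dX dY dZ : measure_display}.
Context {X : measurableType dX} {Y : measurableType dY}
        {Yhat : measurableType dZ}.
Variables (psi : Yhat -> Yhat -> Y -> R) (B : R).
Hypothesis hpsi_meas : measurable_fun [set: Yhat * Yhat * Y]
  (fun z : Yhat * Yhat * Y => psi z.1.1 z.1.2 z.2).
Hypothesis hpsi_anti : antisymmetric_comparison psi.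
Hypothesis hB : forall y' y'' y, - B <= psi y' y'' y <= B.

(** Adding the gap of [(f0, f1)] to the gap under [P] of the trapped pair makes
    it vanish on the data sets that contain [z]; elsewhere the sum is at most the
    gap of the original pair plus [max_gap], which is nonnegative, so that the
    factor [s ^+ n] from the restricted i.i.d. law applies to it. *)
Lemma triggered_gap_le (P P' : probability (X * Y)%type R) (z : X * Y)
    (mz : measurable [set z]) (s : R) (A0 A1 : algorithm R X Y Yhat)
    (f0 f1 : {mfun X >-> Yhat}) n :
  0 < s <= 1 -> scaled_le_on [set: X * Y] s^-1 P P' ->
  scaled_le_on (~` [set z]) s P' P ->
  algorithm_gap psi P' n (triggered A0 mz f1) (triggered A1 mz f0) <=
  s * (s ^+ n * (algorithm_gap psi P n A0 A1 + max_gap psi P) -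
       model_gap psi P f0 f1) + (1 - s) * B.
Proof.
move=> /andP[s0 s1] PP' P'P.
set M := max_gap psi P; set m := model_gap psi P f0 f1.
rewrite /algorithm_gap; set E := _ `*` _.
have mE : measurable E by exact: measurableX.
(* [measurableTypeR R] is the type that carries the uniform law. *)
pose law (P0 : probability (X * Y)%type R) :
    probability (n.-tuple (X * Y) * measurableTypeR R)%type R :=
  (iid_law P0 n \x uniform_prob (@ltr01 R))%E.
change (\int[law P']_(w in E) model_gap psi P' (triggered A0 mz f1 w.1 w.2)
    (triggered A1 mz f0 w.1 w.2) <=
  s * (s ^+ n *
       (\int[law P]_(w in E) model_gap psi P (A0 w.1 w.2) (A1 w.1 w.2) + M) -
       m) + (1 - s) * B).
pose G (w : n.-tuple (X * Y) * R) := model_gap psi P (A0 w.1 w.2) (A1 w.1 w.2).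
pose H (w : n.-tuple (X * Y) * R) :=
  if z \in (w.1 : seq (X * Y)) then 0 else G w + M.
have mG : measurable_fun E G by exact: measurable_model_gap.
have mH : measurable_fun E H.
  apply: measurable_fun_if => //.
    apply: measurable_funTS.
    apply: (measurableT_comp
            (f := fun t : n.-tuple (X * Y) => z \in (t : seq (X * Y)))
            (g := fun w : n.-tuple (X * Y) * R => w.1)).
      exact: measurable_mem_tuple.
    exact: measurable_fst.
  apply: measurable_funD => //.
  by apply: measurable_funS mG => //.
have GM0 w : 0 <= G w + M by exact: model_gap_add_max_ge0.
have M0 : 0 <= M.
  have := model_gap_le_max hpsi_meas hB P f0 f1.
  have := model_gap_le_max hpsi_meas hB P f1 f0.
  by rewrite (model_gap_antisymmetric hpsi_meas hB)// -/M; lra.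
have HB w : 0 <= H w <= B + M.
  have B0 := bound_ge0 hB.
  rewrite /H; case: ifP => _; first by rewrite lexx/= addr_ge0.
  rewrite GM0 lerD2r/=; apply: le_trans (ler_norm _) _.
  exact: model_gap_bounded.
have intG : (law P).-integrable E (EFin \o G).
  apply: (@bounded_integrable _ _ _ _ _ _ B) => // w _.
  exact: model_gap_bounded.
have intH (nu : probability (n.-tuple (X * Y) * measurableTypeR R)%type R) :
    nu.-integrable E (EFin \o H).
  apply: (@bounded_integrable _ _ _ _ _ _ (B + M)) => // w _.
  by have /andP[H0 H1] := HB w; rewrite ger0_norm.
have intc (nu : probability (n.-tuple (X * Y) * measurableTypeR R)%type R)
    (c : R) : nu.-integrable E (EFin \o cst c).
  exact: finite_measure_integrable_cst.
have massE (P0 : probability (X * Y)%type R) (c : R) :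
    \int[law P0]_(w in E) c = c.
  rewrite Rintegral_cst// /E [X in fine X]product_measure1E//.
  rewrite [X in fine (X * _)%E](probability_setT (iid_law P0 n)) mul1e.
  by rewrite [X in fine X](integral_uniform_pdf1 (@ltr01 R)) ?mulr1.
have untriggered :
    \int[law P']_(w in E) H w <= s ^+ n * \int[law P]_(w in E) H w.
  pose S := [set t : n.-tuple (X * Y) | forall i, (~` [set z]) (tnth t i)].
  have mS : measurable S by apply: measurable_all_tuple; exact: measurableC.
  have H0 w : E w -> ~ (S `*` [set: R]) w -> H w = 0.
    move=> _ nS; rewrite /H; case: ifPn => // /forall_tnthP zw.
    by exfalso; apply: nS.
  rewrite (Rintegral_support (law P') H0) (Rintegral_support (law P) H0).
  apply: (@ge0_Rintegral_scaled_le _ _ _ _ _ _ _ (B + M)).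
  - by apply: measurableI => //; exact: measurableX.
  - by rewrite exprn_ge0// ltW.
  - have := @scaled_le_on_product _ _ _ _ _ (iid_law P' n) (iid_law P n)
      (uniform_prob (@ltr01 R)) (uniform_prob (@ltr01 R)) S setT (s ^+ n) 1.
    rewrite mulr1 => h C mC CS; apply: h => //.
    + by rewrite exprn_ge0// ltW.
    + by apply: scaled_le_on_iid => //; [exact: measurableC|exact: ltW].
    + by move=> A mA _; rewrite mul1e.
    + by move=> w /CS[].
  - by apply: measurable_funS mH.
  - by move=> w _; exact: HB.
have drop_trigger : \int[law P]_(w in E) H w <= \int[law P]_(w in E) G w + M.
  have -> : \int[law P]_(w in E) G w + M = \int[law P]_(w in E) (G w + M).
    by rewrite RintegralD//; [rewrite massE|exact: intc].
  apply: le_Rintegral => //; first exact: intH.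
    by apply: (integrableD _ intG (intc _ M)).
  by move=> w _; rewrite /H; case: ifP.
have pointwise :
    \int[law P']_(w in E) (model_gap psi P' (triggered A0 mz f1 w.1 w.2)
      (triggered A1 mz f0 w.1 w.2)) <=
    \int[law P']_(w in E) (s * H w + ((1 - s) * B - s * m)).
  apply: le_Rintegral => //.
  - apply: (@bounded_integrable _ _ _ _ _ _ B) => //.
      exact: measurable_model_gap.
    by move=> w _; exact: model_gap_bounded.
  - have intsH : (law P').-integrable E (EFin \o (fun w => s * H w)).
      by apply: (integrableZl _ s (intH (law P'))).
    by apply: (integrableD _ intsH (intc _ ((1 - s) * B - s * m))).
  - move=> w _.
    apply: le_trans (model_gap_scaled_le hpsi_meas hB _ _ s0 PP') _.
    suff : model_gap psi P (triggered A0 mz f1 w.1 w.2)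
        (triggered A1 mz f0 w.1 w.2) <= H w - m.
      rewrite -(ler_pM2l s0) mulrBr => h.
      by rewrite [leRHS]addrCA [leRHS]addrC lerD2r.
    rewrite /= /triggered_fit /H; case: ifP => _.
      by rewrite (model_gap_antisymmetric hpsi_meas hB)// sub0r.
    by rewrite -/(G w) -addrA lerDl subr_ge0; exact: model_gap_le_max.
apply: le_trans pointwise _.
rewrite RintegralD//;
  [|by apply: (integrableZl _ s (intH (law P')))|exact: intc].
rewrite RintegralZl//; last exact: intH.
rewrite massE.
suff : \int[law P']_(w in E) H w <= s ^+ n * (\int[law P]_(w in E) G w + M).
  rewrite -(ler_pM2l s0) => h.
  by rewrite [leLHS]addrCA [leLHS]addrC mulrBr !lerD2r.
apply: le_trans untriggered _.
by rewrite ler_wpM2l// exprn_ge0// ltW.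
Qed.

End triggered_gap.

(** * The test overlooks the trap *)

Section blindness.
Context {R : realType} {dX dY dZ d : measure_display}.
Context {X : measurableType dX} {Y : measurableType dY}
        {Yhat : measurableType dZ}.
Context {Omega : measurableType d} {Q : probability Omega R}.
Variables (zeta : nat -> {RV Q >-> R})
  (T : algorithm R X Y Yhat -> algorithm R X Y Yhat -> seq (X * Y) ->
       Omega -> bool).
Hypothesis hT : black_box_test zeta T.

(** Once a run on the original pair has stopped, only finitely many points occur
    in its queries. A trap at any other point leaves the whole run unchanged:
    the same histories up to that stage, hence the same stopping time and output.
    The runs on the countably many trapped pairs all terminate almost surely. *)
Lemma test_ae_blind (zk : nat -> X * Y) (mz : forall k, measurable [set zk k])
    (A0 A1 : algorithm R X Y Yhat) (f0 f1 : {mfun X >-> Yhat})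
    (D : seq (X * Y)) :
  injective zk ->
  {ae Q, forall w, exists k0, forall k, (k0 <= k)%N ->
    T (triggered A0 (mz k) f0) (triggered A1 (mz k) f1) D w = T A0 A1 D w}.
Proof.
move=> inj; have [query [stop [output [_ run _]]]] := hT.
have runk : {ae Q, forall w, forall k, exists r : nat,
    let H := history query (triggered A0 (mz k) f0) (triggered A1 (mz k) f1) D
               (fun i => zeta i w) in
    [/\ (0 < r)%N, stop D (H r), (forall s, (0 < s < r)%N -> ~~ stop D (H s)) &
      T (triggered A0 (mz k) f0) (triggered A1 (mz k) f1) D w =
      output D (H r) (zeta 0%N w)]}.
  by apply/ae_foralln => k; exact: run.
apply: filterS2 (run A0 A1 D) runk => w [r [r0 stopr nstop ->]] hk.
set H := history query A0 A1 D (fun i => zeta i w) in stopr nstop *.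
have [k0 hk0] : exists k0, forall k, (k0 <= k)%N ->
    all (fun q : round => zk k \notin round_data q) (H r).
  elim: (H r) => [|q h [k0 IH]]; first by exists 0%N.
  suff [k1 h1] : exists k1, forall k, (k1 <= k)%N -> zk k \notin round_data q.
    exists (maxn k0 k1) => k; rewrite geq_max => /andP[k0k k1k] /=.
    by rewrite h1// IH.
  elim: (round_data q) => [|x t [k1 IHt]]; first by exists 0%N.
  have [[j xj]|nx] := pselect (exists j, zk j = x).
    exists (maxn k1 j.+1) => k; rewrite geq_max => /andP[k1k jk].
    rewrite inE negb_or IHt// andbT; apply: contraTneq jk => zkx.
    by rewrite (inj k j) ?ltnn// zkx.
  exists k1 => k k1k; rewrite inE negb_or IHt// andbT.
  by apply/eqP => zkx; apply: nx; exists k.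
exists k0 => k /hk0 fresh.
have same := triggered_history (mz k) f0 f1 fresh.
have [r' [r'0 stopr' nstop' ->]] := hk k.
suff -> : r' = r by rewrite same.
have [rr'|rr'|//] := ltngtP r' r.
- by move: stopr'; rewrite same ?(ltnW rr')// (negbTE (nstop _ _))// r'0.
- by have := nstop' r; rewrite r0 rr' same// stopr => /(_ isT).
Qed.

End blindness.

Lemma exists_injective_sequence {dX dY} {X : measurableType dX}
    {Y : measurableType dY} :
  infinite_set [set: X] \/ infinite_set [set: Y] ->
  exists z : nat -> X * Y, injective z.
Proof.
have seq (T : pointedType) : infinite_set [set: T] ->
    exists t : nat -> T, injective t.
  move=> /infiniteP /pcard_injP[t inj]; exists t => i j tij.
  by apply: inj tij; rewrite inE.
case=> /seq[t inj].
  by exists (fun k => (t k, point)) => i j [] /inj.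
by exists (fun k => (point, t k)) => i j [] /inj.
Qed.

Section rejection.
Context {R : realType} {dX dY dZ d : measure_display}.
Context {X : measurableType dX} {Y : measurableType dY}
        {Yhat : measurableType dZ}.
Context {Omega : measurableType d} {Q : probability Omega R}.
Variables (zeta : nat -> {RV Q >-> R})
  (T : algorithm R X Y Yhat -> algorithm R X Y Yhat -> seq (X * Y) ->
       Omega -> bool).
Hypothesis hT : black_box_test zeta T.

Lemma measurable_rejection N (A0 A1 : algorithm R X Y Yhat) :
  measurable [set w : N.-tuple (X * Y) * Omega | T A0 A1 w.1 w.2 = true].
Proof.
have [_ [_ [_ [_ _ mT]]]] := hT.
by have := mT A0 A1 N measurableT [set true]; rewrite setTI; exact.
Qed.

Lemma rejection_prob_itv (P : probability (X * Y)%type R) N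
    (A0 A1 : algorithm R X Y Yhat) :
  (0 <= rejection_prob Q T P N A0 A1 <= 1)%E.
Proof.
by rewrite measure_ge0 probability_le1//; exact: measurable_rejection.
Qed.

(** The point [z_k] is chosen before [P'], so that the contamination may be
    centred at [z_k] itself. *)
Lemma rejection_prob_transfer (P : probability (X * Y)%type R) N
  (A0 A1 : algorithm R X Y Yhat) (f0 f1 : {mfun X >-> Yhat})
  (zk : nat -> X * Y) (mz : forall k, measurable [set zk k]) (e : R) :
  injective zk -> 0 < e ->
  exists k, forall (P' : probability (X * Y)%type R) (s : R), 0 < s ->
    scaled_le_on [set: X * Y] s^-1 P P' ->
    (rejection_prob Q T P N A0 A1 <=
     ((s ^+ N)^-1)%:E * rejection_prob Q T P' N (triggered A0 (mz k) f0)
                                           (triggered A1 (mz k) f1) + e%:E)%E.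
Proof.
move=> inj e0.
pose A0' k := triggered A0 (mz k) f0; pose A1' k := triggered A1 (mz k) f1.
pose rej (C0 C1 : algorithm R X Y Yhat) :=
  [set w : N.-tuple (X * Y) * Omega | T C0 C1 w.1 w.2 = true].
have mrej C0 C1 : measurable (rej C0 C1) by exact: measurable_rejection.
pose F k := rej A0 A1 `\` rej (A0' k) (A1' k).
have mF k : measurable (F k) by exact: measurableD.
have Fae (D : N.-tuple (X * Y)) : {ae Q, forall w, exists k0, forall k,
    (k0 <= k)%N -> ~ F k (D, w)}.
  apply: filterS (test_ae_blind hT mz A0 A1 f0 f1 D inj) => w [k0 h].
  by exists k0 => k /h; rewrite /F /rej /= => -> [].
have [k Fk] := product_eventually_small (iid_law P N) mF Fae e0.
exists k => P' s s0 PP'; rewrite /rejection_prob.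
have dom : scaled_le_on [set: N.-tuple (X * Y) * Omega] (s ^+ N)^-1
    (iid_law P N \x Q)%E (iid_law P' N \x Q)%E.
  move=> C mC _; rewrite -exprVn -[X in (X%:E * _)%E]mulr1.
  apply: (@scaled_le_on_product _ _ _ _ _ (iid_law P N) (iid_law P' N) Q Q
    [set t | forall i, [set: X * Y] (tnth t i)] [set: Omega]) => //.
  - exact: measurable_all_tuple.
  - by rewrite exprn_ge0// invr_ge0 ltW.
  - by apply: scaled_le_on_iid => //; rewrite invr_ge0 ltW.
  - by move=> B mB _; rewrite mul1e.
apply: (@le_trans _ _ ((iid_law P N \x Q)%E (rej (A0' k) (A1' k) `|` F k))).
  rewrite le_measure ?inE//; [exact: mrej|exact: measurableU|].
  by move=> w Tw; have [|] := pselect (rej (A0' k) (A1' k) w); [left|right].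
apply: (le_trans (measureU2 _ (mrej _ _) (mF k))).
by apply: leeD; [exact: dom|exact: ltW].
Qed.

End rejection.

(** * The choice of the contamination level *)

Section real_estimates.
Context {R : realType}.

Lemma bernoulli_inequality (x : R) N : 0 <= x -> 1 + N%:R * x <= (1 + x) ^+ N.
Proof.
move=> x0; elim: N => [|N IHN]; first by rewrite mul0r addr0 expr0.
have := ler_wpM2l (addr_ge0 ler01 x0) IHN; rewrite -exprS.
apply: le_trans; rewrite -natr1.
have : 0 <= N%:R * x * x by rewrite !mulr_ge0.
by lra.
Qed.

(** From [s ^- N <= alpha^-1], Bernoulli's inequality gives
    [s^-1 - 1 <= (alpha^-1 - 1) / N]. *)
Lemma contamination_cost (s B alpha : R) N : 0 < alpha -> 0 < s <= 1 ->
  (0 < N)%N -> 0 <= B -> alpha <= s ^+ N ->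
  (1 - s) * B <= s * (B * (alpha^-1 - 1) / N%:R).
Proof.
move=> a0 /andP[s0 s1] N0 B0 sN.
have N0' : 0 < N%:R :> R by rewrite ltr0n.
have x0 : 0 <= s^-1 - 1 by rewrite subr_ge0 invf_ge1.
have := bernoulli_inequality N x0; rewrite subrKC exprVn => bern.
have : (s ^+ N)^-1 <= alpha^-1 by rewrite lef_pV2 ?posrE// exprn_gt0.
move=> /(le_trans bern) h.
have : s^-1 - 1 <= (alpha^-1 - 1) / N%:R.
  by rewrite ler_pdivlMr// mulrC; lra.
move=> /(ler_wpM2l B0) /(ler_wpM2l (ltW s0)).
by rewrite [X in X <= _](_ : _ = (1 - s) * B) ?mulrA//; field; exact: lt0r_neq0.
Qed.

(** The two conditions on [s] ask for [s ^+ N > alpha / p] and [s ^+ n < K^-1].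
    They are compatible because [(K^-1) `^ (N / n) > alpha / p]; the witness has
    [s ^+ N = alpha / q] for a [q] strictly between the two sides of the
    hypothesis. *)
Lemma powR_bound_gt (alpha K p : R) (n N : nat) :
  0 < alpha -> 1 < K -> (0 < n)%N -> (0 < N)%N ->
  alpha * K `^ (N%:R / n%:R) < p ->
  exists s : R, [/\ 0 < s, s < 1, alpha < p * s ^+ N & K * s ^+ n < 1].
Proof.
move=> a0 K1 n0 N0 hp.
have one_powR (r : R) : 1 `^ r = 1 by rewrite powR1.
have n0' : 0 < n%:R :> R by rewrite ltr0n.
have N0' : 0 < N%:R :> R by rewrite ltr0n.
have K0 : 0 < K by exact: lt_trans K1.
have KN1 : 1 < K `^ (N%:R / n%:R).
  rewrite -[ltLHS](one_powR (N%:R / n%:R)).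
  apply: gt0_ltr_powR; rewrite ?nnegrE//.
    by rewrite divr_gt0.
  exact: ltW.
pose q := (alpha * K `^ (N%:R / n%:R) + p) / 2.
have [qK qp] : alpha * K `^ (N%:R / n%:R) < q /\ q < p by rewrite /q; lra.
have aK : alpha < alpha * K `^ (N%:R / n%:R) by rewrite ltr_pMr.
have q0 : 0 < q by lra.
have r0 : 0 < alpha / q by rewrite divr_gt0.
pose s := (alpha / q) `^ (N%:R)^-1.
have s0 : 0 < s by exact: powR_gt0.
have sN : s ^+ N = alpha / q.
  by rewrite -powR_mulrn ?powR_ge0// -powRrM mulVf ?gt_eqF// powRr1// ltW.
exists s; split => //.
- rewrite -[ltRHS](one_powR (N%:R)^-1).
  apply: gt0_ltr_powR; rewrite ?nnegrE ?invr_gt0//.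
    exact: ltW.
  by rewrite ltr_pdivrMr// mul1r; lra.
- rewrite sN mulrCA ltr_pMr// ltr_pdivlMr ?mul1r//.
- have -> : s ^+ n = (alpha / q) `^ (n%:R / N%:R).
    by rewrite -powR_mulrn ?powR_ge0// -powRrM [_^-1 * _]mulrC.
  have KE : K = (K `^ (N%:R / n%:R)) `^ (n%:R / N%:R).
    rewrite -powRrM (_ : _ * _ = 1) ?powRr1 ?ltW//.
    by field; rewrite !gt_eqF.
  rewrite [X in X * _]KE -powRM ?powR_ge0 ?ltW//.
  rewrite -[ltRHS](one_powR (n%:R / N%:R)).
  apply: gt0_ltr_powR; rewrite ?nnegrE//.
  + by rewrite divr_gt0.
  + by rewrite mulr_ge0// ?powR_ge0 ?ltW.
  + by rewrite mulrA ltr_pdivrMr// mul1r mulrC.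
Qed.

End real_estimates.

(** * The power bound *)

Theorem theorem5 (R : realType) (dX dY dZ d : measure_display)
  (X : measurableType dX) (Y : measurableType dY) (Yhat : measurableType dZ)
  (Omega : measurableType d) (Q : probability Omega R)
  (zeta : nat -> {RV Q >-> R}) (hzeta : iid_uniform zeta)
  (hsingleton : forall z : X * Y, measurable [set z])
  (alpha : R) (halpha : 0 < alpha < 1)
  (n N : nat) (hn : (1 <= n)%N) (hN : (1 <= N)%N)
  (psi : Yhat -> Yhat -> Y -> R)
  (hpsi_meas : measurable_fun [set: Yhat * Yhat * Y]
     (fun z : Yhat * Yhat * Y => psi z.1.1 z.1.2 z.2))
  (hpsi_anti : antisymmetric_comparison psi)
  (hinf : infinite_set [set: X] \/ infinite_set [set: Y])
  (B : R) (hB : forall y' y'' y, - B <= psi y' y'' y <= B)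
  (T : algorithm R X Y Yhat -> algorithm R X Y Yhat -> seq (X * Y) ->
       Omega -> bool)
  (hT : black_box_test zeta T)
  (hvalid : forall (A0 A1 : algorithm R X Y Yhat)
     (P : probability (X * Y)%type R),
     algorithm_gap psi P n A0 A1 <= 0 ->
     (rejection_prob Q T P N A0 A1 <= alpha%:E)%E)
  (A0 A1 : algorithm R X Y Yhat) (P : probability (X * Y)%type R)
  (hgap : 0 < algorithm_gap psi P n A0 A1)
  (hmax : B * (alpha^-1 - 1) / N%:R < max_gap psi P) :
  (rejection_prob Q T P N A0 A1 <=
   (Num.min
     (alpha *
      (1 + (algorithm_gap psi P n A0 A1 + B * (alpha^-1 - 1) / N%:R) /
           (max_gap psi P - B * (alpha^-1 - 1) / N%:R))
      `^ (N%:R / n%:R))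
     1)%:E)%E.
Proof.
have /andP[a0 a1] := halpha.
have B0 := bound_ge0 hB.
set M := max_gap psi P in hmax *.
set G := algorithm_gap psi P n A0 A1 in hgap *.
set b := B * (alpha^-1 - 1) / N%:R in hmax *.
have b0 : 0 <= b.
  by rewrite divr_ge0// mulr_ge0// subr_ge0 invf_ge1// ltW.
set K := 1 + (G + b) / (M - b).
have Mb : 0 < M - b by rewrite subr_gt0.
have K1 : 1 < K by rewrite ltrDl divr_gt0// ltr_wpDr.
set rho := rejection_prob Q T P N A0 A1.
have /andP[rho0 rho1] : (0 <= rho <= 1)%E
  by exact: (rejection_prob_itv hT).
have rho_fin : rho \is a fin_num.
  by rewrite ge0_fin_numE// (le_lt_trans rho1)// ltry.
rewrite -(fineK rho_fin) lee_fin le_min; apply/andP; split; last first.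
  by rewrite -lee_fin fineK.
set p := fine rho; rewrite leNgt; apply/negP => hp.
have [s [s0 s1 ps Ks]] := powR_bound_gt a0 K1 hn hN hp.
have p1 : p <= 1 by rewrite -lee_fin fineK.
have sN0 : 0 < s ^+ N by rewrite exprn_gt0.
(* What [Ks] leaves to spare tells how close to [M] the gap of the trap models
   has to be. *)
have slack : 0 < (M - b) - s ^+ n * (G + M).
  have KE : G + M = K * (M - b) by rewrite /K mulrDl divfK ?gt_eqF//; lra.
  by rewrite KE mulrA [s ^+ n * K]mulrC subr_gt0 -[ltRHS]mul1r ltr_pM2r.
have [_ [f _ <-] /ltW near_max] :=
  sup_adherent slack (has_sup_model_gap hpsi_meas hB P).
have {}near_max : b + s ^+ n * (G + M) <= model_gap psi P f.1 f.2.
  by apply: le_trans near_max; rewrite -/(max_gap psi P) -/M; lra.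
have [zk inj] := exists_injective_sequence hinf.
(* [p] still exceeds [alpha / s ^+ N] after half of the difference is spent on
   the runs that find the trap. *)
have e0 : 0 < p - alpha / s ^+ N by rewrite subr_gt0 ltr_pdivrMr.
have [k transfer] := rejection_prob_transfer hT P N A0 A1 f.2 f.1
  (fun k => hsingleton (zk k)) inj (divr_gt0 e0 (ltr0n R 2)).
have s01 : 0 < s <= 1 by rewrite s0 ltW.
have [P' [PP' P'P]] := contamination_exists P (hsingleton (zk k)) s01.
set A0' := triggered A0 _ _ in transfer.
set A1' := triggered A1 _ _ in transfer.
have gap' : algorithm_gap psi P' n A0' A1' <= 0.
  apply: le_trans (triggered_gap_le hpsi_meas hpsi_anti hB _
    A0 A1 f.1 f.2 n s01 PP' P'P) _.
  have cost : (1 - s) * B <= s * b.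
    apply: contamination_cost => //.
    by rewrite (le_trans (ltW ps))// ler_piMl// ltW.
  apply: le_trans (lerD (lexx _) cost) _; rewrite -mulrDr pmulr_rle0//.
  by rewrite -/M -/G addrAC subr_le0 addrC.
have := transfer P' s s0 PP'.
have := hvalid _ _ _ gap'.
move=> /(lee_wpmul2l _) => /(_ ((s ^+ N)^-1)%:E).
rewrite lee_fin invr_ge0 ltW// => /(_ isT) h.
move=> /le_trans => /(_ _ (leeD h (lexx _))).
rewrite -/rho -(fineK rho_fin) -/p -EFinM -EFinD lee_fin mulrC.
lra.
Qed.
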